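(* For every integer $r\geq 4$ and every positive integer $d$, $$\tau(r+b_d,\,r)\;\leq\;2^{-d},\qquad\text{where } b_d=\left\lfloor \left(2^{d+1}-\tfrac74\right)^{1/2}-\tfrac12\right\rfloor .$$
   Context: An $r$-graph is a pair $H=(V(H),E(H))$ where $V(H)$ is a finite set of vertices and $E(H)$ is a collection of $r$-subsets of $V(H)$. The independence number $\alpha(H)$ is the maximum size of a subset of $V(H)$ which contains no edges of $H$. The degree of a subset $A\subseteq V(H)$ is the number of edges of $H$ containing $A$, and $\Delta_l(H)$ is the maximum degree among $l$-subsets of $V(H)$. Let $$T_{r-1}(n,k,r)=\min\{\Delta_{r-1}(H): H \text{ is an } r\text{-graph with } |V(H)|=n,\ \alpha(H)<k\}.$$ The codegree Turán density is $\tau(k,r)=\lim_{n\to\infty} T_{r-1}(n,k,r)/(n-r+1)$; this limit is known to exist. *)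

(* Defs.v *)
From mathcomp Require Import all_boot all_order all_algebra.
From mathcomp Require Import all_classical all_reals all_analysis.
From mathcomp Require Import lra.
Set Implicit Arguments.
Unset Strict Implicit.
Unset Printing Implicit Defensive.
Import Order.TTheory GRing.Theory Num.Theory.
Import numFieldNormedType.Exports.

Local Open Scope ring_scope.

Definition is_rgraph (V : finType) (r : nat) (E : {set {set V}}) : bool :=
  [forall e in E, #|e| == r].

Definition independent (V : finType) (E : {set {set V}}) (S : {set V}) : bool :=
  [forall e in E, ~~ (e \subset S)].

Definition alpha (V : finType) (E : {set {set V}}) : nat :=
  \max_(S : {set V} | independent E S) #|S|.

Definition degree (V : finType) (E : {set {set V}}) (A : {set V}) : nat :=
  #|[set e in E | A \subset e]|.

Definition Delta (V : finType) (l : nat) (E : {set {set V}}) : nat :=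
  \max_(A : {set V} | #|A| == l) degree E A.

Definition complete_rgraph (V : finType) (r : nat) : {set {set V}} :=
  [set e : {set V} | #|e| == r].

(* T_{r-1}(n, k, r).  Every r-graph on n vertices is isomorphic to one on 'I_n,
   so the minimum is taken over those.  The complete r-graph satisfies
   alpha < k as soon as r <= k, so for r <= k this is a genuine minimum; see
   codegT_attained and codegT_le.  For k < r the minimum may be over an empty
   family and the value is then irrelevant. *)
Definition codegT (n k r : nat) : nat :=
  Delta r.-1 [arg min_(E < complete_rgraph 'I_n r | is_rgraph r E && (alpha E < k)%N)
                Delta r.-1 E]%N.

(* tau(k, r).  The denominator is a subtraction in R, not a truncated one. *)
Definition tau (R : realType) (k r : nat) : R :=
  limn (fun n : nat => (codegT n k r)%:R / (n%:R - r%:R + 1) : R).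

(* truncn is the nat-valued floor on nonnegative arguments; see b_floor. *)
Definition b_ (R : realType) (d : nat) : nat :=
  Num.truncn (Num.sqrt (2 ^+ d.+1 - 7 / 4) - 1 / 2 : R).

Lemma b_floor (R : realType) (d : nat) : (0 < d)%N ->
  (b_ R d)%:Z = Num.floor (Num.sqrt (2 ^+ d.+1 - 7 / 4) - 1 / 2 : R).
Proof.
move=> d0; rewrite /b_ truncn_floor.
suff x0 : 0 <= Num.sqrt (2 ^+ d.+1 - 7 / 4) - 1 / 2 :> R.
  by rewrite x0 gez0_abs // floor_ge0.
have h : (4 : R) <= 2 ^+ d.+1.
  have -> : (4 : R) = 2 ^+ 2 by rewrite expr2; lra.
  by rewrite ler_weXn2l // ler1n.
rewrite subr_ge0 -(@ler_pXn2r _ 2) ?nnegrE ?sqrtr_ge0 ?divr_ge0 //.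
by rewrite sqr_sqrtr; lra.
Qed.

Lemma complete_rgraphP (V : finType) (k r : nat) : (r <= k)%N -> (0 < r)%N ->
  is_rgraph r (complete_rgraph V r) && (alpha (complete_rgraph V r) < k)%N.
Proof.
move=> rk r0; apply/andP; split; first by apply/forall_inP => e; rewrite inE.
suff h : (alpha (complete_rgraph V r) <= r.-1)%N.
  by apply: leq_trans rk; rewrite -[leqRHS](prednK r0) ltnS.
apply/bigmax_leqP => S iS.
rewrite -ltnS (prednK r0) ltnNge; apply/negP => rS.
have : (0 < #|[set A : {set V} | A \subset S & #|A| == r]|)%N.
  by rewrite cards_draws bin_gt0.
case/card_gt0P => e; rewrite inE => /andP[eS er].
by have := forall_inP iS e; rewrite inE er eS => /(_ isT).
Qed.

Lemma codegT_attained (n k r : nat) : (r <= k)%N -> (0 < r)%N ->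
  exists E : {set {set 'I_n}},
    [/\ is_rgraph r E, (alpha E < k)%N & Delta r.-1 E = codegT n k r].
Proof.
move=> rk r0; rewrite /codegT; case: arg_minnP; first exact: complete_rgraphP.
by move=> E /andP[? ?] _; exists E.
Qed.

Section transport.
Variables (V W : finType) (f : V -> W).
Hypothesis fbij : bijective f.
Let finj : injective f := bij_inj fbij.
Let Finj : injective (fun A : {set V} => f @: A) := imset_inj finj.

Definition map_graph (E : {set {set V}}) : {set {set W}} :=
  [set f @: (e : {set V}) | e in E].

Let preK (S : {set W}) : f @: (f @^-1: S) = S.
Proof.
case: fbij => g _ gK; apply/setP => w; apply/imsetP/idP => [[v] | wS].
  by rewrite inE => ? ->.
by exists (g w); rewrite ?inE gK.
Qed.

Let subE (A B : {set V}) : (f @: A \subset f @: B) = (A \subset B).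
Proof.
apply/idP/idP => [/fintype.subsetP AB|]; last exact: imsetS.
by apply/fintype.subsetP => x xA; have := AB _ (imset_f f xA); rewrite mem_imset.
Qed.

Lemma map_is_rgraph r E : is_rgraph r E -> is_rgraph r (map_graph E).
Proof.
move=> /forall_inP h; apply/forall_inP => _ /imsetP[e eE ->].
by rewrite card_imset // h.
Qed.

Lemma map_alpha E : (alpha (map_graph E) <= alpha E)%N.
Proof.
apply/bigmax_leqP => S /forall_inP iS.
rewrite -(preK S) card_imset // /alpha; apply: (@leq_bigmax_cond _ _ (fun S : {set V} => #|S|)).
apply/forall_inP => e eE; rewrite -subE preK.
by apply: iS; apply: imset_f.
Qed.

Lemma map_Delta l E : (Delta l (map_graph E) <= Delta l E)%N.
Proof.
apply/bigmax_leqP => A; rewrite -(preK A) card_imset // => lA.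
apply: leq_trans (@leq_bigmax_cond _ _ (degree E) _ lA).
rewrite /degree -(card_imset _ Finj); apply: subset_leq_card.
apply/fintype.subsetP => _ /setIdP[/imsetP[e eE ->]]; rewrite subE => Ae.
by apply: imset_f; rewrite inE eE.
Qed.
End transport.

Lemma codegT_le (V : finType) (k r : nat) (E : {set {set V}}) :
  is_rgraph r E -> (alpha E < k)%N -> (r <= k)%N -> (0 < r)%N ->
  (codegT #|V| k r <= Delta r.-1 E)%N.
Proof.
move=> Er Ek rk r0; rewrite /codegT; case: arg_minnP.
  exact: complete_rgraphP.
move=> F _ /(_ (map_graph (@enum_rank V) E)) Fmin.
apply: leq_trans (map_Delta (@enum_rank_bij V) _ _); apply: Fmin.
apply/andP; split; first by apply: map_is_rgraph => //; exact: enum_rank_bij.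
by apply: leq_ltn_trans Ek; apply: map_alpha; exact: enum_rank_bij.
Qed.

(* Main.v *)
Require Import Defs.
From mathcomp Require Import all_boot all_order all_algebra.
From mathcomp Require Import all_classical all_reals all_analysis.
From mathcomp Require Import fintype finset zify ring lra.
Set Implicit Arguments.
Unset Strict Implicit.
Unset Printing Implicit Defensive.
Import Order.TTheory GRing.Theory Num.Theory.
Import numFieldNormedType.Exports.

Local Open Scope ring_scope.

(** Let L be the group (Z/2)^d and s = r - 4.  For r = 4, give each vertex a
    label in L, each label being used about equally often, and take as edges the
    quadruples of vertices whose labels sum to zero.  Three vertices determine
    the label of a fourth one, so the codegrees are about n / 2^d; and four among
    any b + 4 vertices, b = b_d, sum to zero, because the distinct labels of a
    set without zero-sum quadruples form a Sidon set, and C(b + 2, 2) >= 2^d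
    ([zero_sum_quad], [exp2_le_bin_b]).

    For larger r, order the vertices and let the s lowest vertices of an r-set
    decide which labelling is used for its four highest ones.  The s lowest
    vertices of a set of r + b vertices then fix a labelling for the b + 4
    others, so the bound on the independence number is inherited
    ([alpha_top_checks_lt]).  For the codegrees, the labellings must be such that,
    when r - 1 vertices are fixed and the last one varies, the sum of the four
    labels is nearly equidistributed in L, wherever the last vertex falls in the
    order.  A random choice works: the label of y relative to a set D is
    w (y, y) + \sum_(x in D) w (y, x), with w uniformly random.  For a fixed
    (r - 1)-set the number of its extensions to an edge is a sum of independent
    indicators of probability 2^-d, and its exponential moments beat the union
    bound over the polynomially many (r - 1)-sets ([expmoment_extensions],
    [exists_checks_low_codegree]).  Hence all codegrees are at most
    (2^-d + o(1)) n. *)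

(** * Zero-sum quadruples in elementary abelian 2-groups *)

Section ZeroSum.
Variables (T : finType) (L : finZmodType).
Hypothesis addLL : forall l : L, l + l = 0.
Implicit Types (f : T -> L) (S : {set T}).

Lemma addLL_eq (l m : L) : l + m = 0 -> l = m.
Proof. by move=> h; rewrite -[l]addr0 -(addLL m) addrA h add0r. Qed.

(** The two copies of the sum over the intersection cancel. *)
Lemma sum_symdiff_eq0 f (A B : {set T}) :
  \sum_(x in A) f x = \sum_(x in B) f x -> \sum_(x in (A :\: B) :|: (B :\: A)) f x = 0.
Proof.
move=> h; have dis : [disjoint A :\: B & B :\: A].
  by rewrite disjoints_subset; apply/subsetP => x; rewrite !inE; case: (x \in A); case: (x \in B).
rewrite (eq_bigl [predU A :\: B & B :\: A]); last by move=> x; rewrite !inE.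
rewrite bigU //=.
have hA := @big_setID _ 0 +%R _ A B f.
have hB := @big_setID _ 0 +%R _ B A f.
rewrite /= h in hA; rewrite /= hA setIC in hB.
by move/addrI: hB => ->; rewrite addLL.
Qed.

(** A set of labels with no four summing to zero is a Sidon set: the sums of
    its pairs are pairwise distinct, and nonzero since the labels are distinct.
    There are only #|L| - 1 nonzero sums. *)
Lemma zero_sum_quad_inj f S :
  {in S &, injective f} -> (#|L| <= 'C(#|S|, 2))%N ->
  exists Q : {set T}, [/\ Q \subset S, #|Q| = 4%N & \sum_(x in Q) f x = 0].
Proof.
move=> finj hL.
pose P := [set e : {set T} | e \subset S & #|e| == 2%N].
pose g (e : {set T}) := \sum_(x in e) f x.
have gne e : e \in P -> g e != 0.
  rewrite inE => /andP[eS /cards2P[x [y [xy ee]]]]; rewrite /g ee big_setU1 ?big_set1 ?inE //=.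
  apply/negP => /eqP /addLL_eq fxy; move: eS; rewrite ee subUset !sub1set => /andP[xS yS].
  by move: xy; rewrite (finj _ _ xS yS fxy) eqxx.
have [e [e' [eP e'P ee' gee']]] : exists e e', [/\ e \in P, e' \in P, e != e' & g e = g e'].
  apply/not_existsP => h.
  have ginj : {in P &, injective g}.
    move=> e e' eP e'P gee'; apply/eqP/negPn/negP => ne.
    by apply: (h e); exists e'.
  have : (#|g @: P| <= #|[set l : L | l != 0%R]|)%N.
    apply: subset_leq_card; apply/subsetP => _ /imsetP[e eP ->].
    by rewrite inE gne.
  rewrite card_in_imset // cards_draws.
  have -> : [set l : L | l != 0%R] = ~: [set (0%R : L)] by apply/setP => l; rewrite !inE.
  by have := cardsC [set (0%R : L)]; rewrite cards1 => c1 /(leq_trans hL); rewrite -c1 add1n ltnn.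
move: eP e'P; rewrite !inE => /andP[eS /eqP e2] /andP[e'S /eqP e'2].
(* Two 2-sets with equal sums cannot meet in one point, since the remaining
   two points would carry equal labels; so their union has four points. *)
have cI := cardsID e' e; have cI' := cardsID e e'; rewrite setIC e2 in cI; rewrite e'2 in cI'.
have z := sum_symdiff_eq0 gee'.
have cU : #|(e :\: e') :|: (e' :\: e)| = (#|e :\: e'| + #|e' :\: e|)%N.
  rewrite cardsU -[X in (_ - X)%N]/(#|_|) (_ : _ :&: _ = set0) ?cards0 ?subn0 //.
  by apply/setP => x; rewrite !inE; case: (x \in e); case: (x \in e').
exists ((e :\: e') :|: (e' :\: e)); split=> //.
  by rewrite subUset !(subset_trans (subsetDl _ _)).
rewrite cU; case I: #|e' :&: e| cI cI' => [|[|i]] cI cI'; first by lia.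
  have Q2 : #|(e :\: e') :|: (e' :\: e)| = 2 by lia.
  have : (e :\: e') :|: (e' :\: e) \in P.
    by rewrite inE Q2 subUset !(subset_trans (subsetDl _ _)).
  by move=> /gne; rewrite /g z eqxx.
case/negP: ee'; rewrite eqEcard e2 e'2 leqnn andbT -setD_eq0 -cards_eq0; lia.
Qed.

(** Now labels may repeat.  Two disjoint pairs of vertices with equal labels form
    a zero-sum quadruple; so unless two of them occur, deleting at most one such
    pair leaves an injectively labelled set, which still has b + 2 elements. *)
Lemma zero_sum_quad f S b :
  (b + 4 <= #|S|)%N -> (#|L| <= 'C(b.+2, 2))%N ->
  exists Q : {set T}, [/\ Q \subset S, #|Q| = 4%N & \sum_(x in Q) f x = 0].
Proof.
move=> cS hL.
have step S' : (b.+2 <= #|S'|)%N ->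
  (exists Q : {set T}, [/\ Q \subset S', #|Q| = 4%N & \sum_(x in Q) f x = 0]) \/
  (exists x y, [/\ x \in S', y \in S', x != y & f x = f y]).
  move=> cS'; case: (pselect {in S' &, injective f}) => [finj|ninj].
    left; apply: zero_sum_quad_inj => //; apply: (leq_trans hL).
    exact: leq_bin2l.
  right; apply: contra_notP ninj => h x y xS yS fxy.
  by apply/eqP/negPn/negP => xy; apply: h; exists x, y.
have [|//|[x [y [xS yS xy fxy]]]] := step S; first by lia.
have sub : S :\: [set x; y] \subset S by exact: subsetDl.
have cS' : (b.+2 <= #|S :\: [set x; y]|)%N.
  rewrite cardsD (setIidPr _) ?cards2 ?xy; first by lia.
  by rewrite subUset !sub1set xS.
have [|[Q [QS Q4 Q0]]|[u [v [uS vS uv fuv]]]] := step (S :\: [set x; y]).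
- exact: cS'.
- by exists Q; split=> //; exact: subset_trans sub.
move: uS vS; rewrite !inE !negb_or => /andP[/andP[ux uy] uS] /andP[/andP[vx vy] vS].
exists [set x; y; u; v]; split.
- by rewrite !subUset !sub1set xS yS uS.
- rewrite -!setUA !cardsU1 cards1 !inE !negb_or.
  by rewrite xy uv ![x == _]eq_sym ![y == _]eq_sym ux uy vx vy.
rewrite -!setUA !big_setU1 ?big_set1 /= ?inE ?negb_or.
- by rewrite fuv addLL addr0 fxy addLL.
- by [].
- by rewrite ![y == _]eq_sym uy vy.
- by rewrite xy ![x == _]eq_sym ux vx.
Qed.

End ZeroSum.

(** * Random hypergraphs given by parity checks *)

Lemma bin_le_exp n m : ('C(n, m) <= n ^ m)%N.
Proof.
apply: (@leq_trans (n ^_ m)); first by rewrite -bin_ffact leq_pmulr ?fact_gt0.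
rewrite ffact_prod -[m in (n ^ m)%N]card_ord -prod_nat_const.
by apply: leq_prod => i _; exact: leq_subr.
Qed.

(** The vertex set is V; the coordinates of the random word w are the elements
    of C.  An r-set e is an edge when w satisfies the check supported on P e. *)
Definition check_graph (V C : finType) (L : finZmodType) (P : {set V} -> {set C}) (r : nat)
    (w : {ffun C -> L}) : {set {set V}} :=
  [set e : {set V} | (#|e| == r) && (\sum_(p in P e) w p == 0)].

(** Each coordinate is owned by a vertex, and the check of a set e involves only
    coordinates owned by elements of e, and at least one owned by each of them.
    The second condition makes each check uniformly distributed; the first makes
    the checks of x |: A, for x outside a fixed set A, independent, because the
    one of x involves coordinates owned by x while the others do not. *)
Section RandomChecks.
Variables (R : realType) (V C : finType) (L : finZmodType).
Variables (owner : C -> V) (P : {set V} -> {set C}).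
Hypothesis P_owner : forall (e : {set V}) p, p \in P e -> owner p \in e.
Hypothesis owner_P : forall (e : {set V}) x, x \in e -> exists2 p, p \in P e & owner p = x.
Implicit Types (A : {set V}) (w : {ffun C -> L}).

Definition extends A w x := (x \notin A) && (\sum_(p in P (x |: A)) w p == 0).

Lemma degree_check_graph_le r A w : #|A| = r ->
  (degree (check_graph P r.+1 w) A <= #|[pred x | extends A w x]|)%N.
Proof.
move=> cA; rewrite /degree.
apply: leq_trans (leq_imset_card (fun x => x |: A) _).
apply: subset_leq_card; apply/subsetP => e; rewrite !inE => /andP[/andP[/eqP er e0] Ae].
have : #|e :\: A| == 1 by rewrite cardsD (setIidPr Ae) er cA subSnn.
case/cards1P => x ex; have : x \in e :\: A by rewrite ex set11.
rewrite inE => /andP[xA xe]; have ee : e = x |: A.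
  by rewrite -{1}(setID e A) (setIidPr Ae) ex setUC.
by apply/imsetP; exists x => //; rewrite inE /extends xA -ee.
Qed.

(** Adds t x to one coordinate k x owned by x, for every vertex x outside A. *)
Definition shift A (k : V -> C) (t : {ffun V -> L}) w : {ffun C -> L} :=
  [ffun p => (w p + (if (owner p \notin A) && (p == k (owner p)) then t (owner p) else 0)) : L].

Lemma shiftE A k t w p :
  shift A k t w p = w p + (if (owner p \notin A) && (p == k (owner p)) then t (owner p) else 0).
Proof. exact: ffunE. Qed.

(** The shifts act on the values of the checks of the sets x |: A by arbitrary
    translations: this is the joint uniformity of these values. *)
Lemma sum_shift A k t w x : x \notin A -> k x \in P (x |: A) -> owner (k x) = x ->
  \sum_(p in P (x |: A)) shift A k t w p = \sum_(p in P (x |: A)) w p + t x.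
Proof.
move=> xA kP ok; under eq_bigr do rewrite shiftE.
rewrite big_split /=; congr (_ + _).
rewrite (bigD1 (k x)) //= ok xA eqxx big1 ?addr0 // => p /andP[pP pk].
case: ifP => // /andP[oA /eqP pE]; have := P_owner pP.
rewrite !inE (negPf oA) orbF => /eqP ox.
by move: pk; rewrite pE ox eqxx.
Qed.

(** Under a uniformly random w, the events that x extends A to an edge are
    independent of probability 1 / #|L|, so that the expectation of
    (1 + c) ^ (number of extensions) is (1 + c / #|L|) ^ #|V :\: A|.  The proof
    averages over all shifts of w; the inequality comes from multiplying also
    over the vertices in A, which keeps the bound simple. *)
Lemma expmoment_extensions (c : R) A : 0 <= c ->
  \sum_w (1 + c) ^+ #|[pred x | extends A w x]| <=
  #|{ffun C -> L}|%:R * (1 + c / #|L|%:R) ^+ #|V|.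
Proof.
move=> c0.
have L0 : (0 : R) < #|L|%:R by rewrite ltr0n; apply/card_gt0P; exists 0.
have [k kP ok] : exists2 k : V -> C, forall x, k x \in P (x |: A) & forall x, owner (k x) = x.
  have h x := owner_P (setU11 x A).
  by exists (fun x => sval (cid2 (h x))) => x; case: cid2.
pose F w := \prod_x (if extends A w x then 1 + c else 1) : R.
have FE w : (1 + c) ^+ #|[pred x | extends A w x]| = F w.
  by rewrite /F -big_mkcond /= prodr_const.
under eq_bigr do rewrite FE.
have inv t : \sum_w F w = \sum_w F (shift A k t w).
  rewrite (reindex_inj (h := shift A k t)) //=.
  apply: (can_inj (g := shift A k [ffun x => - t x : L])) => w.
  apply/ffunP => p; rewrite !shiftE (ffunE (fun x => - t x : L)).
  by case: ifP => _; rewrite ?addr0 // addrK.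
have avg w : \sum_(t : {ffun V -> L}) F (shift A k t w) <= (#|L|%:R + c) ^+ #|V|.
  pose G x (l : L) : R := if (x \notin A) && (\sum_(p in P (x |: A)) w p + l == 0) then 1 + c else 1.
  rewrite (eq_bigr (fun t : {ffun V -> L} => \prod_x G x (t x))); last first.
    move=> t _; apply: eq_bigr => x _; rewrite /G /extends.
    by case xA: (x \in A) => //=; rewrite sum_shift ?xA.
  rewrite -bigA_distr_bigA /= -prodr_const; apply: ler_prod => x _.
  apply/andP; split; first by apply: sumr_ge0 => l _; rewrite /G; case: ifP => _ //; lra.
  pose l0 := - \sum_(p in P (x |: A)) w p.
  apply: (@le_trans _ _ (\sum_l (1 + (if l == l0 then c else 0)))).
    apply: ler_sum => l _; rewrite /G addrC addr_eq0 -/l0.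
    by case: (x \notin A); case: (l == l0) => //=; rewrite ?addr0 // lerDl.
  by rewrite big_split /= -big_mkcond /= big_pred1_eq sumr_const.
have cardLV : (0 : R) < #|{ffun V -> L}|%:R by rewrite card_ffun natrX exprn_gt0.
rewrite -(ler_pM2l cardLV).
have -> : #|{ffun V -> L}|%:R * \sum_w F w = \sum_w \sum_(t : {ffun V -> L}) F (shift A k t w).
  rewrite exchange_big /= -(eq_bigr _ (fun t _ => inv t)) sumr_const mulr_natl.
  by congr (_ *+ _); apply: eq_card.
apply: le_trans (ler_sum _ (fun w _ => avg w)) _.
have -> : #|L|%:R + c = #|L|%:R * (1 + c / #|L|%:R) by rewrite mulrDr mulr1 mulrCA mulfV ?mulr1 ?gt_eqF.
rewrite sumr_const -[leLHS]mulr_natl [in leRHS]card_ffun natrX exprMn mulrCA.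
by rewrite (eq_card (_ : _ =i {ffun C -> L})).
Qed.

(** A union bound: there are at most #|V| ^ m sets A, and the sum over A of the
    exponential moments bounds each of its terms for a suitable w. *)
Lemma exists_checks_low_codegree (c : R) m : 0 <= c ->
  exists w, forall A, #|A| = m ->
    (1 + c) ^+ #|[pred x | extends A w x]| <= #|V|%:R ^+ m * (1 + c / #|L|%:R) ^+ #|V|.
Proof.
move=> c0; apply: contrapT => /forallNP h.
pose B : R := #|V|%:R ^+ m * (1 + c / #|L|%:R) ^+ #|V|.
pose X w A : R := (1 + c) ^+ #|[pred x | extends A w x]|.
have X0 w A : 0 <= X w A by apply: exprn_ge0; lra.
have big w : B < \sum_(A : {set V} | #|A| == m) X w A.
  have /existsNP[A /not_implyP[cA /negP]] := h w; rewrite -ltNge => lt.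
  apply: (lt_le_trans lt); rewrite (bigD1 A) ?cA ?eqxx //= lerDl.
  exact: sumr_ge0.
have : \sum_(w : {ffun C -> L}) B < \sum_(w : {ffun C -> L}) \sum_(A : {set V} | #|A| == m) X w A.
  by apply: ltr_sum => [|w _]; [apply/hasP; exists [ffun=> 0]; rewrite // mem_index_enum|exact: big].
rewrite exchange_big /=; apply/negP; rewrite -leNgt.
apply: le_trans (ler_sum _ (fun A _ => expmoment_extensions A c0)) _.
rewrite !sumr_const -[leLHS]mulr_natl -[leRHS]mulr_natl /B.
rewrite mulrCA ler_wpM2l ?ler0n //.
apply: ler_wpM2r.
  by apply: exprn_ge0; rewrite addr_ge0 // divr_ge0.
by rewrite -natrX ler_nat -cardsE card_draws bin_le_exp.
Qed.

End RandomChecks.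

(** * Checks on the four highest vertices *)

Section TopFour.
Variable n : nat.
Implicit Types (e S D Q : {set 'I_n}).

Definition high e := [set y in e | #|[set z in e | (y < z)%N]| < 4]%N.

(** Relative to the set e :\: high e of its lower vertices, each y in [high e]
    receives the label \sum_x w (y, x), where x ranges over y and the lower
    vertices of e.  The check of e is the sum of the four labels.  Taking x = y
    provides a coordinate owned by y itself; a pair (y, x) is owned by x. *)
Definition top_checks e : {set 'I_n * 'I_n} :=
  [set p | (p.1 \in high e) && ((p.2 == p.1) || (p.2 \in e :\: high e))].

Lemma top_checks_owner e p : p \in top_checks e -> p.2 \in e.
Proof.
rewrite !inE => /andP[/andP[p1 _]] /orP[/eqP->//|/andP[_ //]].
Qed.

Lemma owner_top_checks e x : x \in e -> exists2 p, p \in top_checks e & p.2 = x.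
Proof.
move=> xe; have [xh|xh] := boolP (x \in high e).
  by exists (x, x) => //; rewrite inE xh eqxx.
pose y := [arg max_(i > x in e) val i]%N.
have [ye ymax] : y \in e /\ forall z, z \in e -> (z <= y)%N by rewrite /y; case: arg_maxnP.
exists (y, x) => //; rewrite !inE /= ye xe andbT.
have -> : [set z in e | (y < z)%N] = set0.
  apply/setP => z; rewrite !inE; apply/negbTE/negP => /andP[/ymax].
  by rewrite leqNgt => /negP.
by move: xh; rewrite inE xe /= => ->; rewrite cards0 orbT.
Qed.

Lemma split_lowest S s : (s <= #|S|)%N ->
  exists D, [/\ D \subset S, #|D| = s & {in D & S :\: D, forall x y : 'I_n, (x < y)%N}].
Proof.
elim: s => [|s IHs] cS.
  by exists set0; rewrite sub0set cards0; split=> // x y; rewrite inE.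
have [D [DS cD Dlt]] := IHs (ltnW cS).
have /card_gt0P[x0 x0P] : (0 < #|S :\: D|)%N by rewrite cardsD (setIidPr DS) cD subn_gt0.
pose m := [arg min_(i < x0 in S :\: D) val i]%N.
have [mP mmin] : m \in S :\: D /\ forall z, z \in S :\: D -> (m <= z)%N by rewrite /m; case: arg_minnP.
move: (mP); rewrite inE => /andP[mD mS].
exists (m |: D); split.
- by rewrite subUset sub1set mS DS.
- by rewrite cardsU1 mD cD.
move=> x y; rewrite !inE negb_or => /orP[/eqP->|xD] /andP[/andP[ym yD] yS].
  rewrite ltn_neqAle mmin ?inE ?yD // andbT eq_sym; exact: ym.
by apply: Dlt; rewrite // inE yD.
Qed.

Lemma high_setU D Q : {in D & Q, forall x y : 'I_n, (x < y)%N} -> #|Q| = 4%N -> high (D :|: Q) = Q.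
Proof.
move=> DQ Q4; apply/setP => y; rewrite !inE.
have [yQ|yQ] := boolP (y \in Q); rewrite ?orbT ?orbF /=.
  rewrite -[in X in (_ < X)%N]Q4; apply: proper_card.
  apply/properP; split; last by exists y; rewrite // !inE ltnn andbF.
  apply/subsetP => z; rewrite !inE => /andP[/orP[zD|//] yz].
  by have := DQ _ _ zD yQ; rewrite ltnNge (ltnW yz).
apply/negbTE/negP => /andP[yD]; apply/negP; rewrite -leqNgt -[in X in (X <= _)%N]Q4.
by apply: subset_leq_card; apply/subsetP => z zQ; rewrite !inE zQ orbT DQ.
Qed.

Lemma sum_top_checks (L : finZmodType) (w : {ffun 'I_n * 'I_n -> L}) D Q :
  {in D & Q, forall x y : 'I_n, (x < y)%N} -> #|Q| = 4%N ->
  \sum_(p in top_checks (D :|: Q)) w p =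
  \sum_(y in Q) \sum_(x | (x == y) || (x \in D)) w (y, x).
Proof.
move=> DQ Q4; rewrite pair_big_dep /=.
apply: eq_big => [[y x]|[y x] _ //]; rewrite inE high_setU //=.
congr (_ && (_ || _)); rewrite !inE; have [xD|xD] := boolP (x \in D).
  by rewrite andbT; apply/negP => xQ; have := DQ _ _ xD xQ; rewrite ltnn.
by case: (x \in Q).
Qed.

(** In a set S of s + 4 + b vertices, let D be the s lowest.  The labels of the
    other vertices relative to D are now fixed elements of L, so four of
    them sum to zero; together with D these four vertices form an edge. *)
Lemma alpha_top_checks_lt (L : finZmodType) (w : {ffun 'I_n * 'I_n -> L}) s b :
  (forall l : L, l + l = 0) -> (#|L| <= 'C(b.+2, 2))%N ->
  (alpha (check_graph top_checks (s + 4) w) < s + 4 + b)%N.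
Proof.
move=> addLL hL; have -> : (s + 4 + b = (s + 3 + b).+1)%N by lia.
rewrite ltnS; apply/bigmax_leqP => S /forall_inP iS; rewrite leqNgt; apply/negP => cS.
have [|D [DS cD Dlt]] := @split_lowest S s; first by lia.
pose f y := \sum_(x | (x == y) || (x \in D)) w (y, x).
have [|Q [QS Q4 Q0]] := @zero_sum_quad _ _ addLL f (S :\: D) b _ hL.
  by rewrite cardsD (setIidPr DS) cD; lia.
have DQ : {in D & Q, forall x y : 'I_n, (x < y)%N}.
  by move=> x y xD yQ; apply: Dlt => //; apply: (subsetP QS).
have /iS/negP : D :|: Q \in check_graph top_checks (s + 4) w.
  rewrite inE sum_top_checks // Q0 eqxx andbT cardsU Q4 cD.
  rewrite (_ : D :&: Q = set0) ?cards0 ?subn0 //.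
  apply/setP => x; rewrite !inE; apply/negP => /andP[xD xQ].
  by have := DQ _ _ xD xQ; rewrite ltnn.
by apply; rewrite subUset DS (subset_trans QS (subsetDl _ _)).
Qed.

End TopFour.

Lemma sparse_rgraph (R : realType) (L : finZmodType) (n s b : nat) (c : R) :
  (forall l : L, l + l = 0) -> (#|L| <= 'C(b.+2, 2))%N -> 0 <= c -> (0 < n)%N ->
  exists E : {set {set 'I_n}}, [/\ is_rgraph (s + 4) E, (alpha E < s + 4 + b)%N &
    (1 + c) ^+ Delta (s + 3) E <= n%:R ^+ (s + 3) * (1 + c / #|L|%:R) ^+ n].
Proof.
move=> addLL hL c0 n0.
have [w wP] := exists_checks_low_codegree L (@top_checks_owner n) (@owner_top_checks n) (s + 3) c0.
exists (check_graph (@top_checks n) (s + 4) w); split.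
- by apply/forall_inP => e; rewrite inE => /andP[].
- exact: alpha_top_checks_lt.
rewrite /Delta; apply: (big_ind (fun d => (1 + c) ^+ d <= _)).
- by rewrite expr0 mulr_ege1 // exprn_ege1 ?ler1n // lerDl divr_ge0.
- by move=> d d' hd hd'; rewrite maxnC /maxn; case: ifP.
move=> A /eqP cA; have := wP _ cA; rewrite card_ord; apply: le_trans.
rewrite ler_weXn2l ?lerDl // addnS.
exact: degree_check_graph_le.
Qed.

(** * The choice of the number of labels *)

(** The floor defining [b_ R d] is the solution of this quadratic inequality:
    b + 1 > sqrt (2^(d+1) - 7/4) - 1/2 means (b + 1) (b + 2) + 2 > 2^(d+1),
    and both sides are even. *)
Lemma exp2_le_bin_b (R : realType) d : (2 ^ d <= 'C((b_ R d).+2, 2))%N.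
Proof.
set b := b_ R d.
have h : Num.sqrt (2 ^+ d.+1 - 7 / 4) - 1 / 2 < b.+1%:R :> R by exact: truncnS_gt.
have h2 : 2 ^+ d.+1 < (b.+1 * b.+2 + 2)%:R :> R.
  have : 2 ^+ d.+1 - 7 / 4 < (b.+1%:R + 1 / 2) ^+ 2 :> R.
    have b0 : (0 : R) < b.+1%:R + 1 / 2 by rewrite ltr_wpDl // divr_gt0.
    have [x0|x0] := leP (2 ^+ d.+1 - 7 / 4 : R) 0; first by rewrite (le_lt_trans x0) // exprn_gt0.
    by rewrite -[ltLHS](sqr_sqrtr (ltW x0)) ltr_pXn2r ?nnegrE ?sqrtr_ge0 ?ltW // -ltrBlDr.
  rewrite natrD natrM -[b.+2]addn1 natrD; nra.
move: h2; rewrite -natrX ltr_nat expnS bin2 /= => h2.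
have := odd_double_half (b.+2 * b.+1); rewrite oddM /= negbK andbN add0n; lia.
Qed.

(** * The density *)

(** Taking logarithms, with c / (1 + c) <= ln (1 + c), ln (1 + c p) <= c p and
    ln n <= 2 sqrt n: the exponential moment bound with a small fixed c gives
    N <= (1 + c) p n + O(sqrt n). *)
Lemma Delta_le_of_expmoment (R : realType) (N n m : nat) (c p : R) :
  0 < c -> 0 <= p -> (0 < n)%N -> (1 + c) ^+ N <= n%:R ^+ m * (1 + c * p) ^+ n ->
  N%:R <= p * (1 + c) * n%:R + m%:R * (1 + c^-1) * 2 * Num.sqrt n%:R.
Proof.
move=> c0 p0 n0 h.
have nR : (0 : R) < n%:R by rewrite ltr0n.
have cp0 : 0 <= c * p by rewrite mulr_ge0 // ltW.
have lnc : c / (1 + c) <= ln (1 + c).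
  rewrite -[leRHS]opprK -lnV ?posrE; last by lra.
  have E : 1 + - (c / (1 + c)) = (1 + c)^-1 by field; lra.
  by rewrite lerNr -[in leLHS]E; apply: le_ln1Dx; rewrite ltrN2 ltr_pdivrMr; lra.
have lnn : ln n%:R <= 2 * Num.sqrt n%:R :> R.
  rewrite -{1}[n%:R]sqr_sqrtr ?ler0n // lnXn ?sqrtr_gt0 // mulr_natl ler_wMn2r //.
  by rewrite ltW // ln_sublinear // sqrtr_gt0.
have : N%:R * ln (1 + c) <= m%:R * ln n%:R + n%:R * ln (1 + c * p).
  rewrite !mulr_natl -!lnXn ?posrE //; try lra.
  by rewrite -lnM ?posrE ?exprn_gt0 // ?ler_ln ?posrE ?mulr_gt0 ?exprn_gt0 //; lra.
have lncp : ln (1 + c * p) <= c * p by apply: le_ln1Dx; lra.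
move=> H.
have H2 : N%:R * (c / (1 + c)) <= m%:R * (2 * Num.sqrt n%:R) + n%:R * (c * p).
  apply: (le_trans (ler_wpM2l _ lnc)); rewrite ?ler0n //.
  by apply: (le_trans H); rewrite lerD // ler_wpM2l.
have -> : p * (1 + c) * n%:R + m%:R * (1 + c^-1) * 2 * Num.sqrt n%:R =
   (m%:R * (2 * Num.sqrt n%:R) + n%:R * (c * p)) * ((1 + c) / c) by field; lra.
have -> : N%:R = N%:R * (c / (1 + c)) * ((1 + c) / c) by field; apply/andP; split; lra.
by rewrite ler_wpM2r // divr_ge0; lra.
Qed.

Lemma codegT_eventually (R : realType) (r d : nat) (e : R) : (4 <= r)%N -> 0 < e ->
  exists N : nat, forall n, (N <= n)%N ->
    (codegT n (r + b_ R d) r)%:R / (n%:R - r%:R + 1) <= 2 ^- d + e.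
Proof.
move=> r4 e0; move: (b_ R d) (exp2_le_bin_b R d) => b hb.
have [s rE] : exists s, r = (s + 4)%N by exists (r - 4)%N; lia.
set p : R := 2 ^- d.
have p0 : 0 <= p by rewrite invr_ge0 exprn_ge0.
have p1 : p <= 1 by rewrite invf_le1 ?exprn_ege1 ?exprn_gt0 // ler1n.
pose K : R := (s + 3)%:R * (1 + (e / 2)^-1) * 2.
pose M : R := K + (p + e) * r%:R.
have K0 : 0 <= K by rewrite !mulr_ge0 // addr_ge0 // invr_ge0; lra.
have M0 : 0 <= M by rewrite addr_ge0 // mulr_ge0 //; lra.
(* Beyond this threshold r < n and M * sqrt n <= e / 2 * n. *)
exists (maxn r.+1 (Num.truncn ((2 * M / e) ^+ 2)).+1) => n; rewrite geq_max => /andP[rn Mn].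
have n0 : (0 < n)%N by exact: leq_trans rn.
have nR : (r%:R : R) < n%:R by rewrite ltr_nat.
have n1 : (1 : R) <= Num.sqrt n%:R by rewrite -[leLHS]sqrtr1 ler_sqrt ?ler1n.
have sqrtn : 2 * M / e <= Num.sqrt n%:R.
  have x0 : 0 <= 2 * M / e by rewrite divr_ge0 ?mulr_ge0 // ltW.
  rewrite -[leLHS]ger0_norm // -sqrtr_sqr ler_sqrt ?ler0n //.
  by rewrite ltW // (lt_le_trans (truncnS_gt _)) // ler_nat.
have char2 (l : 'rV['F_2]_d) : l + l = 0.
  by apply/rowP => i; rewrite !mxE addrr_pchar2 // pchar_Fp.
have cardL : #|{: 'rV['F_2]_d}| = (2 ^ d)%N by rewrite card_mx card_Fp // mul1n.
have e2p : 0 < e / 2 by lra.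
have [|E [Er Ea ED]] := @sparse_rgraph R 'rV['F_2]_d n s b (e / 2) char2 _ (ltW e2p) n0.
  by rewrite cardL.
have T : (codegT n (r + b) r <= Delta (s + 3) E)%N.
  rewrite rE -[n in codegT n]card_ord -[(s + 3)%N]/((s + 3).+1.-1) -addnS.
  by apply: codegT_le; rewrite ?leq_addr // addnS.
have D : (Delta (s + 3) E)%:R <= p * (1 + e / 2) * n%:R + K * Num.sqrt n%:R.
  by move: ED; rewrite cardL natrX; exact: Delta_le_of_expmoment e2p p0 n0.
clear ED.
rewrite ler_pdivrMr; last by lra.
apply: (@le_trans _ _ (Delta (s + 3) E)%:R); first by rewrite ler_nat.
apply: (le_trans D).
have sq : Num.sqrt n%:R ^+ 2 = n%:R :> R by rewrite sqr_sqrtr ?ler0n.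
have H : M * Num.sqrt n%:R <= e / 2 * n%:R.
  rewrite -[in leRHS]sq expr2 mulrA ler_wpM2r ?sqrtr_ge0 //.
  by move: sqrtn; rewrite ler_pdivrMr //; lra.
have H2 : (p + e) * r%:R <= (p + e) * r%:R * Num.sqrt n%:R.
  by rewrite ler_peMr // mulr_ge0 //; lra.
have H3 : p * (e / 2) * n%:R <= e / 2 * n%:R.
  by rewrite ler_wpM2r // ler_piMl //; lra.
move: H; rewrite /M mulrDl => H; lra.
Qed.

Theorem mainTheorem7 (R : realType) (r d : nat) (hr : (4 <= r)%N) (hd : (0 < d)%N) :
  tau R (r + b_ R d) r <= 2 ^- d.
Proof.
rewrite /tau; have [cv|ncv] := pselect (cvgn (fun n : nat => (codegT n (r + b_ R d) r)%:R / (n%:R - r%:R + 1) : R)); last first.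
  (* The limit of a divergent sequence is 0 by convention. *)
  by rewrite (dvgP ncv) invr_ge0 exprn_ge0.
apply/ler_addgt0Pr => e e0; apply: limr_le => //.
have [N NP] := codegT_eventually d hr e0.
by exists N.
Qed.
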